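(* Let $(X,\mathcal{I})$ be a Polish ideal space with $\mathcal{I}$ c.c.c., and let $Y$ be an uncountable Polish space. Suppose $F$ is an analytic subset of $X\times Y$ satisfying the following conditions: (1) $F^y\in\mathcal{I}$ for every $y\in Y$; (2) $X\setminus\pi_X(F)\in\mathcal{I}$, where $\pi_X:X\times Y\rightarrow X$ is the projection map; (3) $F_x$ is finite for every $x\in X$. Then there exists a set $T\subseteq Y$ such that $F^{-1}(T)$ is completely $\mathcal{I}$-nonmeasurable.
   Context: $\mathcal{B}(X)$ is the Borel $\sigma$-algebra of $X$. A pair $(X,\mathcal{I})$ is a Polish ideal space if $X$ is an uncountable Polish space and $\mathcal{I}$ is a proper $\sigma$-ideal of subsets of $X$ that contains all singletons and has a Borel base, i.e. every $A\in\mathcal{I}$ is contained in a Borel set belonging to $\mathcal{I}$. Put $\mathcal{B}_+(X)=\mathcal{B}(X)\setminus\mathcal{I}$. The ideal $\mathcal{I}$ is c.c.c. if every family of pairwise disjoint sets from $\mathcal{B}_+(X)$ is countable. For $F\subseteq X\times Y$, $x\in X$, $y\in Y$ and $T\subseteq Y$ put $F_x=\{y\in Y:(x,y)\in F\}$, $F^y=\{x\in X:(x,y)\in F\}$ and $F^{-1}(T)=\{x\in X:F_x\cap T\neq\emptyset\}$. A set $A\subseteq X$ is completely $\mathcal{I}$-nonmeasurable if for every $B\in\mathcal{B}_+(X)$ both $A\cap B\neq\emptyset$ and $(X\setminus A)\cap B\neq\emptyset$. *)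

(* Defs.v *)
From mathcomp Require Import all_boot all_order all_algebra.
From mathcomp Require Import all_classical all_reals all_analysis.

Set Implicit Arguments.
Unset Strict Implicit.
Unset Printing Implicit Defensive.

Import Order.TTheory GRing.Theory Num.Theory.

Local Open Scope classical_set_scope.
Local Open Scope ring_scope.

Definition is_metric (R : realType) (T : Type) (d : T -> T -> R) : Prop :=
  [/\ forall x y, 0 <= d x y,
      forall x y, d x y = 0 <-> x = y,
      forall x y, d x y = d y x
    & forall x y z, d x z <= d x y + d y z].

Definition metrizes (R : realType) (T : topologicalType) (d : T -> T -> R)
    : Prop :=
  forall (x : T) (A : set T),
    nbhs x A <-> exists2 e : R, 0 < e & [set y | d x y < e] `<=` A.

Definition cauchy_seq (R : realType) (T : Type) (d : T -> T -> R)
    (u : nat -> T) : Prop :=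
  forall e : R, 0 < e ->
    exists N : nat, forall m n : nat, (N <= m)%N -> (N <= n)%N ->
      d (u m) (u n) < e.

Definition completely_metrizable (R : realType) (T : topologicalType) : Prop :=
  exists d : T -> T -> R,
    [/\ is_metric d, metrizes d
      & forall u : nat -> T, cauchy_seq d u -> exists x : T, u @ \oo --> x].

Definition separable (T : topologicalType) : Prop :=
  exists2 D : set T, countable D & dense D.

(* [R] only provides the values of the metric. *)
Definition polish (R : realType) (T : topologicalType) : Prop :=
  separable T /\ completely_metrizable R T.

Definition uncountable (T : Type) : Prop := ~ countable [set: T].

Definition borel (T : topologicalType) : set (set T) := <<s @open T >>.

(* The Polish space [P] may be empty, so the empty set is analytic. *)
Definition analytic (R : realType) (T : topologicalType) (A : set T) : Prop :=
  exists (P : topologicalType) (f : P -> T),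
    [/\ polish R P, continuous f & range f = A].

Definition sigma_ideal (T : Type) (I : set (set T)) : Prop :=
  [/\ I set0,
      forall A B : set T, A `<=` B -> I B -> I A
    & forall A : nat -> set T, (forall n, I (A n)) -> I (\bigcup_n A n)].

Definition borel_base (T : topologicalType) (I : set (set T)) : Prop :=
  forall A : set T, I A -> exists B : set T, [/\ borel B, I B & A `<=` B].

Record polish_ideal_space (R : realType) (X : topologicalType)
    (I : set (set X)) : Prop := {
  pis_polish : polish R X;
  pis_uncountable : uncountable X;
  pis_sigma_ideal : sigma_ideal I;
  pis_proper : ~ I [set: X];
  pis_singleton : forall x : X, I [set x];
  pis_borel_base : borel_base I }.

Definition borel_plus (X : topologicalType) (I : set (set X)) : set (set X) :=
  @borel X `\` I.

Definition ccc (X : topologicalType) (I : set (set X)) : Prop :=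
  forall C : set (set X), C `<=` borel_plus I -> trivIset C id -> countable C.

Definition rel_preimage (X Y : Type) (F : set (X * Y)) (T : set Y) : set X :=
  [set x | xsection F x `&` T !=set0].

Definition completely_nonmeasurable (X : topologicalType) (I : set (set X))
    (A : set X) : Prop :=
  forall B : set X, borel_plus I B -> A `&` B !=set0 /\ ~` A `&` B !=set0.

(* Main.v *)
Require Import Defs.
From mathcomp Require Import all_boot all_order all_algebra.
From mathcomp Require Import all_classical all_reals all_analysis.
From mathcomp Require Import wochoice lra.
From Stdlib Require Import Inverse_Image.

(* Off a set of [I], the sets [{x | F_x meets V}] with [V] closed in a countable family are Borel: they are Souslin sets, hence measurable modulo a c.c.c. ideal by Marczewski's theorem. As [F_x] is finite and every [F^y] is in [I], every positive Borel set can be split, up to shrinking, into two positive pieces over which the sections of [F] lie in disjoint open sets. A Cantor scheme of such splittings gives, inside every positive Borel set, continuum many points with pairwise disjoint nonempty sections. There are at most continuum many Borel sets, so a Bernstein-style recursion picks two points in each positive Borel set such that all the picked points have pairwise disjoint sections; [T] is the union of the sections of the first points. *)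

Set Implicit Arguments.
Unset Strict Implicit.
Unset Printing Implicit Defensive.

Import Order.TTheory GRing.Theory Num.Theory.
Local Open Scope classical_set_scope.

(** The [option] values allow for an empty [A], even over an empty [T]. The statement does not
    exclude values outside [A], so some uses filter them. *)
Lemma countable_enum (T : Type) (A : set T) : countable A ->
  exists e : nat -> option T, forall x, A x -> exists n, e n = Some x.
Proof.
move=> cA; have [i iP] := countable_injP _ cA.
exists (fun n => if pselect (exists2 x, A x & i x = n) is left p
                 then Some (s2val (cid2 p)) else None).
move=> x Ax; exists (i x); case: pselect => [p|]; last by case; exists x.
by case: (cid2 p) => z Az /= iz; congr Some; apply: iP => //; exact: mem_set.
Qed.

(** * Selecting disjoint sets by transfinite recursion *)

(** Cardinality below that of [K], put as the absence of a surjection: contradictions come from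
    exhibiting one. *)
Definition smaller (A K : Type) (S : set A) : Prop :=
  forall h : A -> K, h @` S <> [set: K].

(* Restrict a well-order to the least initial segment that [K] is a quotient of, and pull it back along a section of that quotient map. *)
Lemma wf_order_small_segments (K : Type) : exists lt : K -> K -> Prop,
  [/\ well_founded lt, forall j k, j <> k -> lt j k \/ lt k j
    & forall k, smaller K [set j | lt j k]].
Proof.
pose R := sval (well_ordering_principle {classic K}).
have wR : well_order R := svalP (well_ordering_principle {classic K}).
pose lt (j k : {classic K}) := R j k /\ j <> k.
have Rmin (P : set {classic K}) : P !=set0 ->
    exists k, P k /\ forall j, P j -> R k j.
  case=> k Pk; have [|z [[/set_mem Pz minz] _]] := wR (fun j => j \in P).
    by exists k; exact: mem_set.
  by exists z; split=> // j /mem_set; exact: minz.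
have Rasym j k : R j k -> R k j -> j = k.
  move=> jk kj.
  by apply: (wo_chain_antisymmetric (withinW (A := predT) wR)) => //; rewrite jk.
have wflt : well_founded lt.
  move=> k; apply: contrapT => nk.
  have [z [nz minz]] := Rmin [set k | ~ Acc lt k] (ex_intro _ k nk).
  apply: nz; constructor => y [Ryz yz]; apply: contrapT => ny.
  by apply: yz; apply: Rasym => //; exact: minz.
have ltT j k : j <> k -> lt j k \/ lt k j.
  move=> jk; have [z [zjk minz]] : exists z, [set j; k] z /\
      forall i, [set j; k] i -> R z i by apply: Rmin; exists j; left.
  case: zjk minz => -> minz.
    by left; split=> //; apply: minz; right.
  by right; split; [apply: minz; left|exact: nesym].
have [small|] := pselect (forall k : K, smaller K [set j | lt j k]).
  by exists lt.
move=> /existsNP nsmall.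
have [a [na mina]] := Rmin [set k | ~ smaller K [set j | lt j k]] nsmall.
move: na => /existsNP[h /contrapT hT].
have /choice[phi phiP] (k : K) : exists j, lt j a /\ h j = k.
  have : [set: K] k by [].
  by rewrite -hT => -[j ja <-]; exists j.
exists (fun j k => lt (phi j) (phi k)); split.
- exact: wf_inverse_image.
- move=> j k jk; apply: ltT => /(congr1 h).
  by rewrite (phiP j).2 (phiP k).2.
- move=> k g gT; have [[Rka neka] _] := phiP k.
  (* A surjection [g] on the new segment of [k], composed with [h], is one on the old segment of
     [phi k], against the minimality of [a]. *)
  apply: neka; apply: Rasym => //; apply: mina => /(_ (g \o h)); apply.
  apply/seteqP; split=> // y _.
  have : [set: K] y by [].
  rewrite -gT => -[j jk <-]; exists (phi j) => //=.
  by rewrite (phiP j).2.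
Qed.

(* Koenig's argument: were every index bad at stage [j], some column [n] of the enumerations would map the initial segment of [j] onto [K]. *)
Lemma disjoint_selection (K Y : Type) (S : K -> (nat -> K) -> set Y) :
  (forall j b, countable (S j b)) ->
  (forall j b c y, S j b y -> S j c y -> b = c) ->
  exists c : K -> nat -> K,
    forall j k y, S j (c j) y -> S k (c k) y -> j = k.
Proof.
move=> cS dS; have [lt [wf ltT small]] := wf_order_small_segments K.
have next j (c : K -> nat -> K) : exists b,
    forall i, lt i j -> forall y, S j b y -> ~ S i (c i) y.
  apply: contrapT => /forallNP bad.
  have /choice[e eP] i : exists e : nat -> option Y,
    forall y, S i (c i) y -> exists n, e n = Some y :=
    countable_enum (cS i (c i)).
  have bad' b : exists n i y, [/\ lt i j, e i n = Some y & S j b y].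
    have /existsNP[i /not_implyP[ij /existsNP[y /not_implyP[Sy]]]] := bad b.
    move=> /contrapT Siy.
    by have [n en] := eP _ _ Siy; exists n, i, y.
  have [n nP] : exists n, forall k, exists b i y,
      [/\ b n = k, lt i j, e i n = Some y & S j b y].
    apply: contrapT => /forallNP nn.
    (* If every column missed a value, the sequence [b] of missed values would contradict [bad']. *)
    have /choice[b bP] n : exists k, ~ exists b i y,
        [/\ b n = k, lt i j, e i n = Some y & S j b y] by apply/existsNP; exact: nn.
    have [n [i [y [ij ey Sy]]]] := bad' b.
    by apply: (bP n); exists b, i, y.
  (* The pair [(i, n)] fixes [y], which lies in [S j b] for at most one [b], so [h i] is well
     defined; [j] is a mere default. *)
  have /choice[h hP] i : exists k, forall b y,
      e i n = Some y -> S j b y -> b n = k.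
    have [[b [y [ey Sy]]]|no] := pselect (exists b y, e i n = Some y /\ S j b y).
      exists (b n) => b' y'; rewrite ey => -[<-] Sy'.
      by rewrite (dS _ _ _ _ Sy' Sy).
    by exists j => b y ey Sy; case: no; exists b, y.
  apply: (small j h); apply/seteqP; split=> // k _.
  have [b [i [y [<- ij ey Sy]]]] := nP k.
  by exists i => //; rewrite (hP _ _ _ ey Sy).
pose good j (c : K -> nat -> K) := sval (cid (next j c)).
have goodP j c i y : lt i j -> S j (good j c) y -> ~ S i (c i) y.
  by move=> ij; rewrite /good; case: cid => b /= /(_ _ ij); exact.
pose step j (c : forall i, lt i j -> nat -> K) : nat -> K :=
  good j (fun i => if pselect (lt i j) is left p then c i p else fun=> j).
pose c := Fix wf (fun=> nat -> K) step.
have cE j : c j = step j (fun i _ => c i).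
  rewrite /c Fix_eq // => x f g fg; congr step.
  by apply: functional_extensionality_dep => y;
    apply: functional_extensionality_dep => p; exact: fg.
have dis i j y : lt i j -> S j (c j) y -> ~ S i (c i) y.
  move=> ij; rewrite [c j]cE => /(goodP _ _ _ _ ij).
  by case: pselect.
exists c => j k y Sj Sk; apply: contrapT => /ltT[jk|kj].
  exact: dis jk Sk Sj.
exact: dis kj Sj Sk.
Qed.

(** * Souslin sets *)

Section Metric.
Local Open Scope ring_scope.
Context (R : realType) (T : topologicalType) (d : T -> T -> R).
Hypotheses (md : is_metric d) (td : metrizes d).

Lemma dist0 x : d x x = 0.
Proof. by have [_ /(_ x x)[_ ->]] := md. Qed.

Lemma distC x y : d x y = d y x.
Proof. by have [_ _ ->] := md. Qed.

Lemma dist_triangle y x z : d x z <= d x y + d y z.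
Proof. by have [_ _ _] := md. Qed.

Lemma dist_gt0 x y : x <> y -> 0 < d x y.
Proof.
have [ge0 eq0 _ _] := md; rewrite lt_neqAle ge0 andbT => xy.
by apply/eqP => /esym/eq0.
Qed.

Lemma nbhs_dist x e : 0 < e -> nbhs x [set y | d x y < e].
Proof. by move=> e0; apply/td; exists e. Qed.

Lemma cvg_dist (u : nat -> T) x e : u @ \oo --> x -> 0 < e ->
  exists N, forall n, (N <= n)%N -> d x (u n) < e.
Proof.
by move=> ux e0; have [N _ NP] := ux _ (nbhs_dist x e0); exists N => n /NP.
Qed.

Lemma eq_dist_le x y : (forall e, 0 < e -> d x y < e) -> x = y.
Proof.
by move=> xy; apply: contrapT => /dist_gt0 /xy; rewrite ltxx.
Qed.

Lemma open_dist x e : open [set y | d x y < e].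
Proof.
rewrite openE => y /= xy; apply/td; exists (e - d x y); first by rewrite subr_gt0.
by move=> z /= yz; have := dist_triangle y x z; lra.
Qed.

End Metric.

Lemma invS_lt (R : realType) (e : R) : (0 < e)%R -> exists n : nat, (n.+1%:R^-1 < e)%R.
Proof.
by move=> e0; have [N _ /(_ N (leqnn N))] := near_infty_natSinv_lt (PosNum e0); exists N.
Qed.

Lemma invS_gt0 (R : realType) n : (0 < n.+1%:R^-1 :> R)%R.
Proof. by rewrite invr_gt0. Qed.

Lemma invS_le (R : realType) m n : (m <= n)%N -> (n.+1%:R^-1 <= m.+1%:R^-1 :> R)%R.
Proof. by move=> mn; rewrite lef_pV2 ?posrE ?ltr0n // ler_nat. Qed.

Section Borel.
Context (T : topologicalType).
Implicit Types A B : set T.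

Lemma borelC A : borel A -> borel (~` A).
Proof. by rewrite -setTD; exact: sigma_algebraCD. Qed.

Lemma borel_bigcup (A : nat -> set T) :
  (forall n, borel (A n)) -> borel (\bigcup_n A n).
Proof. exact: sigma_algebra_bigcup. Qed.

Lemma borel_setT : borel [set: T].
Proof. by rewrite -setC0; apply: borelC; exact: sigma_algebra0. Qed.

Lemma borelU A B : borel A -> borel B -> borel (A `|` B).
Proof.
move=> bA bB; rewrite -bigcup2E; apply: borel_bigcup => -[|[|n]] //.
exact: sigma_algebra0.
Qed.

Lemma borelI A B : borel A -> borel B -> borel (A `&` B).
Proof.
move=> bA bB; rewrite -[A `&` B]setCK setCI.
by apply: borelC; apply: borelU; exact: borelC.
Qed.

Lemma borel_closed A : closed A -> borel A.
Proof.
move=> cA; rewrite -[A]setCK; apply: borelC.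
by apply: sub_gen_smallest; rewrite /= openC.
Qed.

End Borel.

Definition agree n (s t : nat -> nat) := forall i, (i < n)%N -> s i = t i.

Section Souslin.
Context (X : topologicalType).
Implicit Types (A : set X) (C : set (X * (nat -> nat))).

(* [C] is closed in the product of [X] with the Baire space. *)
Definition closed_rel C := forall x s,
  (forall U n, nbhs x U -> exists y t, [/\ C (y, t), U y & agree n s t]) ->
  C (x, s).

(** The results of the Souslin operation on closed sets, written as projections along the Baire
    space. *)
Definition souslin A := exists2 C, closed_rel C & fst @` C = A.

Lemma souslin_closed A : closed A -> souslin A.
Proof.
move=> cA; exists [set p | A p.1].
  move=> x s adh; apply: cA => U /(adh _ 0)[y [t [Ay Uy _]]].
  by exists y.
by apply/seteqP; split=> [x [[y s] /= Ay <-]//|x Ax]; exists (x, fun=> 0%N).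
Qed.

Definition union_rel (C : nat -> set (X * (nat -> nat))) :=
  [set p | C (p.2 0%N) (p.1, fun i => p.2 i.+1)].

Lemma closed_union_rel (C : nat -> set (X * (nat -> nat))) :
  (forall k, closed_rel (C k)) -> closed_rel (union_rel C).
Proof.
move=> cC x s adh; apply: cC => U n /(adh _ n.+1)[y [t [Ct Uy st]]].
exists y, (fun i => t i.+1); split=> //; last by move=> i ni; exact: st.
by move: Ct; rewrite /union_rel /= st.
Qed.

Lemma fst_union_rel (C : nat -> set (X * (nat -> nat))) :
  fst @` union_rel C = \bigcup_k fst @` C k.
Proof.
apply/seteqP; split=> [x [[y s] Cs <-]|x [k _ [[y s] Cs <-]]].
  by exists (s 0%N) => //; exists (y, fun i => s i.+1).
by exists (y, fun i => if i is j.+1 then s j else k).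
Qed.

(* The Baire space is identified with its countable power through [pickle]. *)
Definition inter_rel (C : nat -> set (X * (nat -> nat))) :=
  [set p | forall k, C k (p.1, fun i => p.2 (pickle (k, i)))].

Lemma closed_inter_rel (C : nat -> set (X * (nat -> nat))) :
  (forall k, closed_rel (C k)) -> closed_rel (inter_rel C).
Proof.
move=> cC x s adh k; apply: cC => U n.
move=> /(adh _ (\max_(i < n) pickle (k, val i)).+1)[y [t [Ct Uy st]]].
exists y, (fun i => t (pickle (k, i))); split=> //.
move=> i ni; apply: st; rewrite ltnS.
exact: (leq_bigmax (Ordinal ni)).
Qed.

Lemma fst_inter_rel (C : nat -> set (X * (nat -> nat))) :
  fst @` inter_rel C = \bigcap_k fst @` C k.
Proof.
apply/seteqP; split=> [x [[y s] Cs <-] k _|x Cx].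
  by exists (y, fun i => s (pickle (k, i))).
have /choice[s sP] k : exists s, C k (x, s).
  by have [[y s] Cs /= <-] := Cx k I; exists s.
exists (x, fun m => if unpickle m is Some (k, i) then s k i else 0%N) => // k.
rewrite /= (_ : (fun i => _) = s k); first exact: sP.
by apply: funext => i; rewrite pickleK.
Qed.

Lemma souslin_bigcup (A : nat -> set X) :
  (forall k, souslin (A k)) -> souslin (\bigcup_k A k).
Proof.
move=> sA; have /choice[C /all_and2[cC CA]] k :
    exists C, closed_rel C /\ fst @` C = A k by have [C] := sA k; exists C.
exists (union_rel C); first exact: closed_union_rel.
by rewrite fst_union_rel; apply: eq_bigcupr => k _.
Qed.

Lemma souslin_bigcap (A : nat -> set X) :
  (forall k, souslin (A k)) -> souslin (\bigcap_k A k).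
Proof.
move=> sA; have /choice[C /all_and2[cC CA]] k :
    exists C, closed_rel C /\ fst @` C = A k by have [C] := sA k; exists C.
exists (inter_rel C); first exact: closed_inter_rel.
by rewrite fst_inter_rel; apply: eq_bigcapr => k _.
Qed.

Lemma souslin_open (R : realType) (d : X -> X -> R) A :
  is_metric d -> metrizes d -> open A -> souslin A.
Proof.
move=> md td oA.
(* The points at distance at least [1/(k+1)] from the complement form a closed set. *)
have -> : A = \bigcup_k [set x | forall y, (d x y < k.+1%:R^-1)%R -> A y].
  apply/seteqP; split=> [x Ax|x [k _ /(_ x)]]; last first.
    by rewrite (dist0 md); apply; exact: invS_gt0.
  have /td[e e0 eA] : nbhs x A by exact: open_nbhs_nbhs.
  by have [k ke] := invS_lt e0; exists k => // y /lt_trans/(_ ke)/eA.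
apply: souslin_bigcup => k; apply: souslin_closed => x adh y xy.
have [|z [Az /= xz]] := adh [set z | (d x z < k.+1%:R^-1 - d x y)%R].
  by apply: nbhs_dist => //; rewrite subr_gt0.
apply: Az; have := dist_triangle md x z y; rewrite (distC md z x).
by move: (k.+1%:R^-1)%R xy xz => e *; lra.
Qed.

(** The sets that are Souslin together with their complements form a sigma-algebra containing the
    open sets. *)
Lemma souslin_borel (R : realType) (d : X -> X -> R) A :
  is_metric d -> metrizes d -> borel A -> souslin A.
Proof.
move=> md td bA; suff [] : (souslin A /\ souslin (~` A)) by [].
apply: (bA [set A | souslin A /\ souslin (~` A)]); split; last first.
  move=> U oU; split; first exact: souslin_open md td oU.
  by apply: souslin_closed; rewrite closedC.
split.
- split; first by apply: souslin_closed; exact: closed0.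
  by rewrite setC0; apply: souslin_closed; exact: closedT.
- by move=> B [sB sCB]; rewrite /= setTD setCK.
- move=> B sB; split; first by apply: souslin_bigcup => k; have [] := sB k.
  by rewrite setC_bigcup; apply: souslin_bigcap => k; have [] := sB k.
Qed.

(** Substitute for refining the topology to make [H] clopen: a point is coded by a witness for [H]
    or for its complement, and the first value tells which. *)
Lemma borel_decide (R : realType) (d : X -> X -> R) (H : set X) :
  is_metric d -> metrizes d -> borel H -> exists C, [/\ closed_rel C,
    fst @` C = setT & forall x s, C (x, s) -> H x <-> s 0%N = 0%N].
Proof.
move=> md td bH.
have [C cC CH] := souslin_borel md td bH.
have [D cD DH] := souslin_borel md td (borelC bH).
exists (union_rel (fun k => if k is 0 then C else D)); split.
- by apply: closed_union_rel => -[].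
- rewrite fst_union_rel -subTset => x _; have [Hx|nHx] := pselect (H x).
    by exists 0%N => //; rewrite CH.
  by exists 1%N => //; rewrite DH.
- move=> x s; rewrite /union_rel /=; case: (s 0%N) => [|n] h.
    by split=> // _; rewrite -CH; eexists; first exact: h.
  by split=> // Hx; suff: (~` H) x by []; rewrite -DH; eexists; first exact: h.
Qed.

(** A point of [D] is coded by indices of dense points approximating it ever more closely;
    completeness of [P] recovers a point of [D] from a code. *)
Lemma souslin_image (R : realType) (P : topologicalType) (d : X -> X -> R)
    (f : P -> X) (D : set P) :
  is_metric d -> metrizes d -> polish R P -> continuous f -> closed D ->
  souslin (f @` D).
Proof.
move=> md td [[Q cQ dQ] [dP [mP tP compP]]] cf cD.
have [e eP] := countable_enum cQ.
pose close i k p := exists2 q, e k = Some q & (dP q p < i.+1%:R^-1)%R.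
(* Phrased as an adherence condition, the relation is closed by construction. *)
exists [set p | forall U n, nbhs p.1 U -> exists z,
    [/\ D z, U (f z) & forall i, (i < n)%N -> close i (p.2 i) z]].
  move=> x s adh U n /= /nbhs_interior/(adh _ n)[y [t [/= Cy Uy st]]].
  have [z [Dz Uz tz]] := Cy U n Uy.
  by exists z; split=> // i ni; rewrite st //; exact: tz.
apply/seteqP; split=> [_ [[x s] /= Cxs <-]|_ [z Dz <-]]; last first.
  have /choice[s sP] i : exists k, close i k z.
    have zz : (dP z z < i.+1%:R^-1)%R by rewrite (dist0 mP); exact: invS_gt0.
    have [q [zq Qq]] := dQ _ (ex_intro _ z zz) (open_dist mP tP _ _).
    have [k ek] := eP q Qq.
    by exists k, q => //; rewrite (distC mP).
  exists (f z, s) => // U n Ufz; exists z; split=> //.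
  exact: nbhs_singleton.
have /choice[u uP] n : exists z, [/\ D z, (d x (f z) < n.+1%:R^-1)%R &
    forall i, (i < n)%N -> close i (s i) z].
  by apply: (Cxs [set y | (d x y < n.+1%:R^-1)%R]); apply: nbhs_dist.
have cu : cauchy_seq dP u.
  move=> r r0; have [|i ir] := @invS_lt R (r / 2)%R; first by rewrite divr_gt0.
  exists i.+1 => m n im inn.
  have [_ _ /(_ i im)[q eq1 qm]] := uP m.
  have [_ _ /(_ i inn)[q2 eq2 qn]] := uP n.
  have E : q2 = q by move: eq2; rewrite eq1 => -[].
  have := dist_triangle mP q (u m) (u n); rewrite (distC mP (u m) q).
  by move: qn qm ir; rewrite E; move: (i.+1%:R^-1)%R => ? *; lra.
have [z uz] := compP _ cu.
exists z.
  apply: (@closed_cvg _ _ \oo _ u D) uz => //.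
  by apply: nearW => n; have [] := uP n.
have fuz : (f \o u) @ \oo --> f z by apply: cvg_comp uz _; exact: cf.
apply: (eq_dist_le md) => r r0.
have r20 : (0 < r / 2)%R by rewrite divr_gt0.
have [N NP] := cvg_dist td fuz r20.
have [k kr] := invS_lt r20.
pose n := maxn N k.
have [_ xn _] := uP n.
have := NP n (leq_maxl _ _); rewrite /= => zn.
have := dist_triangle md (f (u n)) (f z) x.
have := invS_le R (leq_maxr N k); rewrite -/n (distC md (f (u n)) x).
by move: kr xn; move: (n.+1%:R^-1)%R (k.+1%:R^-1)%R => ? ? *; lra.
Qed.

End Souslin.

(** * Measurability modulo a c.c.c. ideal *)

Section Ideal.
Context (X : topologicalType) (I : set (set X)).
Hypothesis sI : sigma_ideal I.

Lemma ideal_sub A B : A `<=` B -> I B -> I A.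
Proof. by have [_ + _] := sI; exact. Qed.

Lemma ideal_bigcup (J : countType) (A : J -> set X) :
  (forall j, I (A j)) -> I (\bigcup_j A j).
Proof.
have [I0 _ IU] := sI => IA.
apply: (@ideal_sub _ (\bigcup_n oapp A set0 (unpickle n))).
  by move=> x [j _ Ax]; exists (pickle j) => //; rewrite pickleK.
by apply: IU => n; case: (unpickle n).
Qed.

Lemma idealU A B : I A -> I B -> I (A `|` B).
Proof.
move=> IA IB; apply: (@ideal_sub _ (\bigcup_b (if b then A else B))).
  by move=> x [Ax|Bx]; [exists true|exists false].
by apply: ideal_bigcup => -[].
Qed.

Lemma ideal_bigcup_finite (T : Type) (F : set T) (A : T -> set X) :
  finite_set F -> (forall t, F t -> I (A t)) -> I (\bigcup_(t in F) A t).
Proof.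
move=> /finite_set_countable/countable_enum[e eP] IA; have [I0 _ _] := sI.
apply: (@ideal_sub _ (\bigcup_n \bigcup_(t in [set t | F t /\ e n = Some t]) A t)).
  move=> x [t Ft Atx]; have [n en] := eP t Ft.
  by exists n => //; exists t.
apply: ideal_bigcup => n; case en : (e n) => [t|].
  have [Ft|nFt] := pselect (F t).
    by apply: ideal_sub (IA t Ft) => x [u [_ [<-]]].
  by apply: ideal_sub I0 => x [u [Fu [tu]]]; case: nFt; rewrite tu.
by apply: ideal_sub I0 => x [u []].
Qed.

Hypothesis cI : ccc I.

(* The complement of a maximal disjoint family of positive Borel sets missing [A]. *)
Lemma ccc_hull (A : set X) : exists H, [/\ borel H, A `<=` H &
  forall B, borel B -> B `<=` H `\` A -> I B].
Proof.
have [E [EP tE maxE]] := ex_maximal_disjoint_subcollection id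
  [set B | borel_plus I B /\ B `<=` ~` A].
have cE : countable E by apply: cI tE => B /EP[].
have [e eP] := countable_enum cE.
pose g n := if e n is Some B then if B \in E then B else set0 else set0.
have UE : \bigcup_n g n = \bigcup_(B in E) B.
  apply/seteqP; split=> [x [n _]|x [B EB Bx]]; rewrite /g.
    by case: (e n) => // B; case: ifP => // /set_mem EB Bx; exists B.
  by have [n en] := eP B EB; exists n => //; rewrite en mem_set.
have bUE : borel (\bigcup_(B in E) B).
  rewrite -UE; apply: borel_bigcup => n; rewrite /g.
  case: (e n) => [B|]; last exact: sigma_algebra0.
  by case: ifP => [/set_mem/EP[[]]|] // _; exact: sigma_algebra0.
exists (~` \bigcup_(B in E) B); split; first exact: borelC.
  by move=> x Ax [B /EP[_ /(_ x)]] BA /BA.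
move=> B bB BH; apply: contrapT => IB.
have dB D : E D -> B `&` D = set0.
  by move=> ED; apply/seteqP; split=> // x [/BH[+ _] Dx]; apply; exists D.
apply: (maxE (B |` E)).
- split; first by move=> D ED; right.
  move=> /(_ B (or_introl erefl))/dB; rewrite setIid => B0.
  by apply: IB; rewrite B0; have [] := sI.
- by move=> D [->|/EP//]; split=> // x /BH[].
- apply/trivIsetP => D D' [->|ED] [->|ED'] /= DD'.
  + by rewrite eqxx in DD'.
  + exact: dB.
  + by rewrite setIC; exact: dB.
  + by move/trivIsetP : tE => /(_ _ _ ED ED' DD').
Qed.

(* Marczewski's argument that the sets measurable modulo [I] are closed under the Souslin operation. *)
Lemma souslin_hull (A : set X) : souslin A ->
  exists H, [/\ borel H, A `<=` H & I (H `\` A)].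
Proof.
move=> [C cC CA].
pose D (s : seq nat) := fst @` (C `&` [set p | forall i, (i < size s)%N -> p.2 i = nth 0%N s i]).
have /choice[H HP] s : exists H, [/\ borel H, D s `<=` H, H `<=` closure (D s) &
    forall B, borel B -> B `<=` H `\` D s -> I B].
  have [H [bH DH HI]] := ccc_hull (D s).
  (* After cutting with the closure, a point in all hulls along a branch is a limit of points of
     [C], so closedness of [C] applies. *)
  exists (H `&` closure (D s)); split.
  - by apply: borelI => //; apply: borel_closed; exact: closed_closure.
  - by move=> x Dx; split; [exact: DH|exact: subset_closure].
  - by move=> x [].
  - by move=> B bB BH; apply: HI => // x /BH[[]].
have [bH DH _ _] := HP [::].
exists (H [::]); split=> //.
  by rewrite -CA => _ [p Cp <-]; apply: DH; exists p.
(* [D s] is the union of the [D (rcons s k)], so the part of [H s] outside the hulls of its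
   successors misses [D s] and lies in [I]. *)
apply: (@ideal_sub _ (\bigcup_s (H s `&` ~` \bigcup_k H (rcons s k)))); last first.
  apply: ideal_bigcup => s; have [bHs _ _] := HP s; apply.
    apply: borelI => //; apply: borelC; apply: borel_bigcup => k.
    by have [] := HP (rcons s k).
  move=> x [Hx nH]; split=> // -[[y t] [Cy ys] /= yx]; apply: nH.
  exists (t (size s)) => //; have [_ + _ _] := HP (rcons s (t (size s))); apply.
  exists (y, t) => //; split=> // i; rewrite size_rcons ltnS nth_rcons /= => si.
  by case: ltngtP si => [/ys//|//|->].
move=> x [Hx nAx]; apply: contrapT => nU; apply: nAx.
(* Off the exceptional set, a point of a hull lies in the hull of some successor; iterating this
   gives the branch [t]. *)
have /choice[g gP] s : exists k, H s x -> H (rcons s k) x.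
  have [[k Hk]|no] := pselect (exists k, H (rcons s k) x); first by exists k.
  by exists 0%N => Hsx; case: nU; exists s => //; split=> // -[k _ Hk]; case: no; exists k.
pose b := fix b n := if n is m.+1 then rcons (b m) (g (b m)) else [::].
pose t n := g (b n).
have bE n : b n = mkseq t n.
  by elim: n => //= n IH; rewrite mkseqS -IH.
have Hb n : H (b n) x by elim: n => //= n; exact: gP.
rewrite -CA; exists (x, t) => //; apply: cC => U n Ux.
have [_ _ /(_ x (Hb n)) clx _] := HP (b n).
have [_ [[[y u] [Cu ub] <-] Uy]] := clx U Ux.
exists y, u; split=> // i ni; move: (ub i); rewrite bE size_mkseq => /(_ ni) /= ->.
by rewrite nth_mkseq.
Qed.

End Ideal.

(** * The Cantor scheme *)

Lemma dense_enum (R : realType) (T : topologicalType) (d : T -> T -> R) :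
  is_metric d -> metrizes d -> separable T -> exists e : nat -> option T,
    forall x r, (0 < r)%R -> exists k q, e k = Some q /\ (d q x < r)%R.
Proof.
move=> md td [D cD dD]; have [e eP] := countable_enum cD.
exists e => x r r0; have xx : (d x x < r)%R by rewrite (dist0 md).
have [q [xq Dq]] := dD _ (ex_intro _ x xx) (open_dist md td _ _).
by have [k ek] := eP q Dq; exists k, q; split=> //; rewrite (distC md).
Qed.

(** The [G k] are finite unions of balls of radius [1/(m+1)] around points of a countable dense
    family. *)
Lemma separating_opens (R : realType) (Y : topologicalType) :
  polish R Y -> exists G : nat -> set Y, (forall k, open (G k)) /\
    forall P Q, finite_set P -> finite_set Q -> P `&` Q = set0 ->
      exists k l, [/\ P `<=` G k, Q `<=` G l & G k `&` G l = set0].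
Proof.
move=> [sY [d [md td _]]]; have [e eP] := dense_enum md td sY.
pose ball m c := [set y | exists q, e c = Some q /\ (d q y < m.+1%:R^-1)%R].
pose G (j : nat * seq nat) := \bigcup_(c in [set` j.2]) ball j.1 c.
have oG j : open (G j).
  apply: bigcup_open => c _; rewrite /ball.
  case: (e c) => [q|]; last first.
    rewrite (_ : [set y | _] = set0); first exact: open0.
    by apply/seteqP; split=> // y [q []].
  rewrite (_ : [set y | _] = [set y | (d q y < j.1.+1%:R^-1)%R]).
    exact: open_dist.
  by apply/seteqP; split=> [y [_ [[<-]]]|y qy] //; exists q.
have cover m (P : set Y) : finite_set P -> exists s, P `<=` G (m, s) /\
    forall c, c \in s -> exists2 p, P p & ball m c p.
  move=> /(@finite_seqP {classic Y})[l ->].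
  have /choice[c cP] (p : {classic Y}) : exists c, ball m c p.
    by have [k [q kq]] := eP p _ (invS_gt0 R m); exists k, q.
  exists (map c l); split=> [p pl|_ /mapP[p pl ->]].
    exists (c p); last exact: cP.
    by rewrite /=; exact: (@map_f {classic Y}).
  by exists p; [exact: pl|exact: cP].
(* The factor 4: a common point [y] of two such unions would link [p] to [q] by four distances below
   the radius. *)
have gap (P Q : set Y) : finite_set P -> finite_set Q -> P `&` Q = set0 ->
    exists m, forall p q, P p -> Q q -> (4 * m.+1%:R^-1 < d p q)%R.
  move=> /(@finite_seqP {classic Y})[l ->] /(@finite_seqP {classic Y})[l' ->] ll'.
  have /choice[M MP] (pq : {classic Y} * {classic Y}) :
      exists m, pq.1 <> pq.2 -> (m.+1%:R^-1 < d pq.1 pq.2 / 4)%R.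
    have [->|npq] := pselect (pq.1 = pq.2); first by exists 0%N.
    have [|m mP] := @invS_lt R (d pq.1 pq.2 / 4)%R; last by exists m.
    by rewrite divr_gt0 //; exact: dist_gt0.
  exists (\max_(pq <- [seq (p, q) | p <- l, q <- l']) M pq) => p q pl ql'.
  have pq : p <> q.
    by move=> pq; have : set0 p by rewrite -ll'; split=> //; rewrite pq.
  have := MP (p, q) pq => /=.
  have in_pq : (p, q) \in [seq (p, q) | p <- l, q <- l'].
    exact: allpairs_f pl ql'.
  have := invS_le R (@leq_bigmax_seq _ _ xpredT M _ in_pq isT).
  by move: (_^-1)%R (_^-1)%R => ? ? *; lra.
exists (fun k => oapp G set0 (unpickle k)); split.
  by move=> k; case: (unpickle k) => //=; exact: open0.
move=> P Q fP fQ PQ; have [m mPQ] := gap P Q fP fQ PQ.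
have [s [Ps sP]] := cover m P fP.
have [t [Qt tQ]] := cover m Q fQ.
exists (pickle (m, s)), (pickle (m, t)); rewrite !pickleK /=; split=> //.
apply/seteqP; split=> // y [[c /= cs [u [eu uy]]] [c' /= ct [v [ev vy]]]].
have [p Pp [u' [eu' up]]] := sP c cs.
have [q Qq [v' [ev' vq]]] := tQ c' ct.
have Eu : u' = u by move: eu'; rewrite eu => -[].
have Ev : v' = v by move: ev'; rewrite ev => -[].
rewrite {}Eu in up; rewrite {}Ev in vq.
suff : (d p q < d p q)%R by rewrite ltxx.
have := mPQ _ _ Pp Qq; have := dist_triangle md u p q.
have := dist_triangle md y u q; have := dist_triangle md v y q.
rewrite (distC md p u) (distC md y v).
by move: (m.+1%:R^-1)%R uy up vy vq => ? *; lra.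
Qed.

Section Scheme.
Context (R : realType) (X : topologicalType) (d : X -> X -> R).
Hypotheses (md : is_metric d) (td : metrizes d) (sX : separable X).

Definition start (s : seq nat) (t : nat -> nat) :=
  forall i, (i < size s)%N -> t i = nth 0%N s i.

Lemma start_mkseq n t u : start (mkseq t n) u <-> agree n t u.
Proof.
rewrite /start size_mkseq; split=> tu i ni; first by rewrite tu ?nth_mkseq.
by rewrite nth_mkseq // tu.
Qed.

(** A closed relation is determined by which of the countably many basic boxes [W j] it meets. *)
Lemma souslin_code : exists code : (nat -> bool) -> set X,
  forall A, souslin A -> exists b, code b = A.
Proof.
have [e eP] := dense_enum md td sX.
pose W (j : nat * nat * seq nat) := [set p : X * (nat -> nat) |
  (exists q, e j.1.1 = Some q /\ (d q p.1 < j.1.2.+1%:R^-1)%R) /\ start j.2 p.2].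
exists (fun b => fst @` [set p | forall j, W j p -> b (pickle j)]) => A [C cC <-].
exists (fun n => if unpickle n is Some j then `[< C `&` W j !=set0 >] else false).
congr image; apply/seteqP; split=> [[x s] Cxs|[x s] Cxs j Wj]; last first.
  by rewrite pickleK; apply/asboolP; exists (x, s).
apply: cC => U n /td[r r0 rU].
have [m mr] : exists m, (m.+1%:R^-1 < r / 2)%R by apply: invS_lt; rewrite divr_gt0.
have [k [q [kq qx]]] := eP x _ (invS_gt0 R m).
have := Cxs (k, m, mkseq s n); rewrite pickleK => Wxs.
have [|[y t] [Cyt [[q' [/= kq' qy]] /start_mkseq st]]] := asboolP _ (Wxs _).
  by split; [exists q|apply/start_mkseq].
exists y, t; split=> //; apply: rU => /=.
have E : q' = q by move: kq'; rewrite kq => -[].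
have := dist_triangle md q x y; rewrite (distC md x q).
by move: qy qx mr; rewrite E; move: (_^-1)%R => ? *; lra.
Qed.

Context (I : set (set X)) (sI : sigma_ideal I).

Definition close_to n (p q : X * (nat -> nat)) :=
  (d p.1 q.1 <= n.+1%:R^-1)%R /\ agree n p.2 q.2.

(** Among the countably many pieces [L j], the projections that lie in [I] add up to a set of [I];
    off it, every piece through a point is positive. *)
Lemma positive_localization C : closed_rel C -> exists2 N, I N &
  forall p n, C p -> ~ N p.1 -> exists Z, [/\ closed_rel Z, Z `<=` C,
    ~ I (fst @` Z) & forall q, Z q -> close_to n p q].
Proof.
move=> cC; have [e eP] := dense_enum md td sX.
(* The non-strict inequality keeps the pieces closed. *)
pose L (j : nat * nat * seq nat) := C `&` [set p : X * (nat -> nat) |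
  (exists q, e j.1.1 = Some q /\ (d q p.1 <= j.1.2.+1%:R^-1)%R) /\ start j.2 p.2].
have cL j : closed_rel (L j).
  move=> x s adh; split.
    by apply: cC => U n /(adh _ n)[y [t [[Cyt _] Uy st]]]; exists y, t.
  have [_ [_ [[_ [[q [eq _]] _]] _ _]]] := adh setT 0%N filterT.
  split=> /=; last first.
    move=> i si; have [y [t [[_ [_ /(_ i si) /= <-]] _ st]]] := adh setT i.+1 filterT.
    exact: st.
  exists q; split=> //; rewrite leNgt; apply/negP => qx.
  have [|y [t [[_ [[q' [/= eq' qy]] _]] /= xy _]]] :=
      adh [set y | (d x y < d q x - j.1.2.+1%:R^-1)%R] 0%N.
    by apply: nbhs_dist => //; rewrite subr_gt0.
  have E : q' = q by move: eq'; rewrite eq => -[].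
  suff : (d q x < d q x)%R by rewrite ltxx.
  have := dist_triangle md y q x; rewrite (distC md y x).
  by move: xy qy; rewrite E; move: (_^-1)%R => ? *; lra.
exists (\bigcup_j [set x | I (fst @` L j) /\ (fst @` L j) x]).
  apply: (ideal_bigcup sI) => j.
  have [IL|nIL] := pselect (I (fst @` L j)).
    by apply: (ideal_sub sI) IL => x [].
  by have [I0 _ _] := sI; apply: (ideal_sub sI) I0 => x [].
move=> [x s] n Cxs Nx.
have [m mn] : exists m, (m.+1%:R^-1 < n.+1%:R^-1 / 2 :> R)%R.
  by apply: invS_lt; rewrite divr_gt0 ?invS_gt0.
have [k [q [kq qx]]] := eP x _ (invS_gt0 R m).
exists (L (k, m, mkseq s n)); split=> //; first by move=> p [].
  move=> IL; apply: Nx; exists (k, m, mkseq s n) => //; split=> //.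
  exists (x, s) => //; split=> //; split; last exact/start_mkseq.
  by exists q; split=> //; exact: ltW.
move=> [y t] [_ [[q' [/= kq' qy]] /start_mkseq st]]; split=> //=.
have E : q' = q by move: kq'; rewrite kq => -[].
have := dist_triangle md q x y; rewrite (distC md x q).
by move: qy qx mn; rewrite E; move: (_^-1)%R (_^-1)%R => ? ? *; lra.
Qed.

Context (Y : topologicalType) (F : set (X * Y)).
Hypotheses (complete : forall u, cauchy_seq d u -> exists x : X, u @ \oo --> x)
  (IF : forall y, I (ysection F y)) (finF : forall x, finite_set (xsection F x)).
Context (C : set (X * (nat -> nat))) (G : nat -> set Y) (len : nat -> nat).
Hypotheses (cC : closed_rel C) (IC : ~ I (fst @` C))
  (sepG : forall P Q, finite_set P -> finite_set Q -> P `&` Q = set0 ->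
      exists k l, [/\ P `<=` G k, Q `<=` G l & G k `&` G l = set0])
  (decG : forall k p q, C p -> C q -> agree (len k) p.2 q.2 ->
      xsection F p.1 `<=` G k -> xsection F q.1 `<=` G k).

Let cond Z := [/\ closed_rel Z, ~ I (fst @` Z) & Z `<=` C].

Let meet_free (Z Z' : set (X * (nat -> nat))) := forall p q, Z p -> Z' q ->
  xsection F p.1 `&` xsection F q.1 = set0.

(** Choose [p] off the exceptional set, then [q] off it and off the finitely many [F^y] with [y] in
    the section of [p]. Some [G k] and [G l] separate the two disjoint sections, and by [decG] small
    enough pieces around [p] and [q] keep all their sections inside these. *)
Lemma positive_splitting n Z : cond Z -> exists Z0 Z1,
  [/\ cond Z0 /\ Z0 `<=` Z, cond Z1 /\ Z1 `<=` Z,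
      exists p, forall q, Z0 q -> close_to n p q,
      exists p, forall q, Z1 q -> close_to n p q & meet_free Z0 Z1].
Proof.
move=> [cZ IZ ZC]; have [N IN NP] := positive_localization cZ.
have avoid A : I A -> exists2 p, Z p & ~ A p.1.
  move=> IA; apply: contrapT => /forall2NP nA; apply: IZ.
  apply: (ideal_sub sI) IA => _ [p Zp <-]; have [//|/contrapT] := nA p.
  by [].
have [p Zp Np] := avoid _ IN.
have [|q Zq] := avoid (N `|` \bigcup_(y in xsection F p.1) ysection F y).
  by apply: (idealU sI) => //; apply: (ideal_bigcup_finite sI).
move=> /not_orP[Nq Fq].
have [|k [l [pk ql kl]]] := sepG (finF p.1) (finF q.1).
  apply/seteqP; split=> // y [py qy]; apply: Fq; exists y => //.
pose h := maxn n (maxn (len k) (len l)).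
have [Z0 [cZ0 Z0Z IZ0 Z0p]] := NP p h Zp Np.
have [Z1 [cZ1 Z1Z IZ1 Z1q]] := NP q h Zq Nq.
have weak m r r' : (m <= h)%N -> close_to h r r' -> close_to m r r'.
  move=> mh [rr ag]; split; first exact: le_trans rr (invS_le R mh).
  by move=> i im; apply: ag; exact: leq_trans im mh.
exists Z0, Z1; split.
- by split=> //; split=> // r /Z0Z/ZC.
- by split=> //; split=> // r /Z1Z/ZC.
- by exists p => r /Z0p/weak; apply; exact: leq_maxl.
- by exists q => r /Z1q/weak; apply; exact: leq_maxl.
move=> r r' Zr Zr'; apply/seteqP; split=> // y [yr yr']; rewrite -kl; split.
  have [_ ag] := weak (len k) _ _ (leq_trans (leq_maxl _ _) (leq_maxr _ _)) (Z0p r Zr).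
  exact: (decG (ZC _ Zp) (ZC _ (Z0Z _ Zr)) ag pk) yr.
have [_ ag] := weak (len l) _ _ (leq_trans (leq_maxr _ _) (leq_maxr _ _)) (Z1q r' Zr').
exact: (decG (ZC _ Zq) (ZC _ (Z1Z _ Zr')) ag ql) yr'.
Qed.

(** Along a branch the pieces shrink in [X] and fix ever longer parts of the code, so closedness
    puts the limit in all of them. Two branches part at a node whose two children satisfy
    [meet_free]. *)
Lemma cantor_scheme : exists x : (nat -> bool) -> X,
  (forall b, (fst @` C) (x b)) /\
  forall b c y, F (x b, y) -> F (x c, y) -> b = c.
Proof.
have /choice[step stepP] (nZ : nat * set (X * (nat -> nat))) :
    exists Z' : bool -> set (X * (nat -> nat)), cond nZ.2 ->
      (forall i, [/\ cond (Z' i), Z' i `<=` nZ.2 &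
         exists p, forall q, Z' i q -> close_to nZ.1 p q]) /\
      meet_free (Z' true) (Z' false).
  have [cZ|] := pselect (cond nZ.2); last by exists (fun=> setT).
  have [Z0 [Z1 [[c0 s0] [c1 s1] p0 p1 fr]]] := positive_splitting nZ.1 cZ.
  by exists (fun i => if i then Z0 else Z1) => _; split=> // -[].
pose tree := fix tree u := if u is i :: v then step (size v, tree v) i else C.
have ctree u : cond (tree u).
  by elim: u => [|i u IH]; [split|have [/(_ i)[]] := stepP (size u, tree u) IH].
have treeP i u : [/\ cond (tree (i :: u)), tree (i :: u) `<=` tree u &
    exists p, forall q, tree (i :: u) q -> close_to (size u) p q].
  by have [] := stepP (size u, tree u) (ctree u); move/(_ i).
(* The first [n] values of [b], latest first, as [tree] reads them. *)
pose node (b : nat -> bool) := fix node n := if n is m.+1 then b m :: node m else [::].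
have size_node b n : size (node b n) = n by elim: n => //= n ->.
have nested b m n : (m <= n)%N -> tree (node b n) `<=` tree (node b m).
  elim: n => [|n IH]; first by rewrite leqn0 => /eqP ->.
  rewrite leq_eqVlt => /orP[/eqP ->//|/IH +]; apply: subset_trans.
  by have [] := treeP (b n) (node b n).
have limit b : exists p, forall n, tree (node b n) p.
  have /choice[u uP] n : exists p, tree (node b n) p.
    have [_ IZ _] := ctree (node b n); apply: contrapT => /forallNP no.
    apply: IZ; have [I0 _ _] := sI.
    by apply: (ideal_sub sI) I0 => y [p /no].
  have near n m m' : (n < m)%N -> (n < m')%N ->
      (d (u m).1 (u m').1 <= n.+1%:R^-1 * 2)%R /\ agree n (u m).2 (u m').2.
    move=> nm nm'; have [_ _ [p]] := treeP (b n) (node b n).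
    rewrite size_node => pP.
    have [pm am] := pP _ (nested b _ _ nm _ (uP m)).
    have [pm' am'] := pP _ (nested b _ _ nm' _ (uP m')).
    split; last by move=> i ni; rewrite -am // am'.
    have := dist_triangle md p.1 (u m).1 (u m').1; rewrite (distC md _ p.1).
    by move: pm pm'; move: (_^-1)%R => ? *; lra.
  have [|x ux] := @complete (fst \o u).
    move=> r r0; have [k kr] : exists k, (k.+1%:R^-1 < r / 2)%R.
      by apply: invS_lt; rewrite divr_gt0.
    exists k.+1 => m n km kn; have [+ _] := near k m n km kn.
    by move: kr => /=; move: (_^-1)%R => ? *; lra.
  (* All [u m] with [m] at least [i + 2] agree at entry [i], since [near] at [i.+1] needs indices
     beyond [i + 1]. *)
  exists (x, fun i => (u i.+2).2 i) => n.
  have [cZ _ _] := ctree (node b n); apply: cZ => U k /ux[N _ NU].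
  pose m := maxn N (maxn n k.+1).
  have [Nm nm km] : [/\ (N <= m)%N, (n <= m)%N & (k < m)%N].
    by rewrite !leq_max !leqnn !orbT.
  exists (u m).1, (u m).2; split.
  - by rewrite -surjective_pairing; exact: nested nm _ (uP m).
  - exact: NU.
  - move=> i ik; have [_ ag] := near i.+1 i.+2 m (ltnSn _) (leq_ltn_trans ik km).
    exact: ag.
have /choice[p pP] := limit.
exists (fun b => (p b).1); split=> [b|b c y Fb Fc].
  by exists (p b) => //; exact: (pP b 0%N).
apply: contrapT => bc.
have [n nbc] : exists n, b n != c n.
  apply: contrapT => /forallNP no; apply: bc; apply: funext => n.
  by apply/eqP/negPn/negP; exact: no.
case: (ex_minnP (ex_intro (fun n => b n != c n) n nbc)) => m mbc minm.
have E : node b m = node c m.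
  have : forall k, (k <= m)%N -> node b k = node c k.
    elim=> //= k IH km; rewrite IH; last exact: ltnW.
    by congr cons; apply/eqP/negPn/negP => /minm; rewrite leqNgt km.
  exact.
have Zb : step (size (node b m), tree (node b m)) (b m) (p b) := pP b m.+1.
have Zc : step (size (node b m), tree (node b m)) (c m) (p c).
  by rewrite E; exact: (pP c m.+1).
have [_ free] := stepP (size (node b m), tree (node b m)) (ctree _).
move/xsectionP in Fb; move/xsectionP in Fc.
have contra Z0 Z1 q0 q1 : meet_free Z0 Z1 -> Z0 q0 -> Z1 q1 ->
    xsection F q0.1 y -> xsection F q1.1 y -> False.
  move=> fr Zq0 Zq1 y0 y1; have : set0 y by rewrite -(fr _ _ Zq0 Zq1).
  by [].
move: mbc Zb Zc; case: (b m) (c m) => -[] // _ Zb Zc.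
  exact: contra free Zb Zc Fb Fc.
exact: contra free Zc Zb Fc Fb.
Qed.

End Scheme.

(** * Disjoint sections inside a positive Borel set *)

Lemma souslin_rel_preimage (R : realType) (X Y : topologicalType)
    (F : set (X * Y)) (V : set Y) :
  polish R X -> analytic R F -> closed V -> souslin (rel_preimage F V).
Proof.
move=> [_ [d [md td _]]] [P [f [pP cf fF]]] cV.
have cf1 : continuous (fst \o f).
  by move=> p; apply: continuous_comp; [exact: cf|exact: cvg_fst].
have cf2 : continuous (snd \o f).
  by move=> p; apply: continuous_comp; [exact: cf|exact: cvg_snd].
(* As [F] is the range of [f], the preimage is the image of a closed subset of [P] under the first
   coordinate. *)
have -> : rel_preimage F V = (fst \o f) @` ((snd \o f) @^-1` V).
  apply/seteqP; split=> [x [y [/xsectionP + Vy]]|_ [p Vp <-]].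
    by rewrite -fF => -[p _ fp]; exists p; rewrite /= fp.
  exists (f p).2; split=> //; apply/xsectionP.
  by rewrite -fF -surjective_pairing; exists p.
apply: (souslin_image md td pP cf1).
by apply: preimage_closed => // p _; exact: cf2.
Qed.

Section DisjointSections.
Context (R : realType) (X Y : topologicalType) (I : set (set X))
  (F : set (X * Y)).
Hypotheses (pI : polish_ideal_space R I) (cI : ccc I) (pY : polish R Y)
  (aF : analytic R F) (IF : forall y : Y, I (ysection F y))
  (fullF : I (~` (fst @` F))) (finF : forall x : X, finite_set (xsection F x)).

(** Off a Borel set [N] of [I], [H k] is exactly the set of points whose section is not inside
    [G k]. A code in [C] records membership in every [H k], which gives the hypothesis [decG] of the
    scheme. *)
Lemma disjoint_sections_in (B : set X) : borel_plus I B ->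
  exists x : (nat -> bool) -> X,
    (forall b, B (x b) /\ xsection F (x b) !=set0) /\
    forall b c y, F (x b, y) -> F (x c, y) -> b = c.
Proof.
move=> [bB IB]; have sI := pis_sigma_ideal pI.
have [sX [d [md td complete]]] := pis_polish pI.
have [G [oG sepG]] := separating_opens pY.
have /choice[H HP] k : exists H, [/\ borel H, rel_preimage F (~` G k) `<=` H &
    I (H `\` rel_preimage F (~` G k))].
  apply: (souslin_hull sI cI); apply: souslin_rel_preimage aF _.
    exact: pis_polish pI.
  by rewrite closedC.
(* [N] covers the points with empty section and the excess of each hull; being Borel, it leaves [B]
   minus [N] Souslin. *)
have [N [bN IN NP]] : exists N, [/\ borel N, I N &
    ~` (fst @` F) `|` \bigcup_k (H k `\` rel_preimage F (~` G k)) `<=` N].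
  apply: (pis_borel_base pI); apply: (idealU sI) => //.
  by apply: (ideal_bigcup sI) => k; have [] := HP k.
have [C0 cC0 C0B] : souslin (B `&` ~` N).
  by apply: (souslin_borel md td); apply: borelI => //; exact: borelC.
have /choice[D DP] k : exists D, [/\ closed_rel D, fst @` D = setT &
    forall x s, D (x, s) -> H k x <-> s 0%N = 0%N].
  by apply: (borel_decide md td); have [] := HP k.
(* Component [0] witnesses membership in [B] minus [N]; component [k + 1] decides [H k] and, having
   full projection, removes no point. *)
pose C := inter_rel (fun k => if k is m.+1 then D m else C0).
have cC : closed_rel C.
  by apply: closed_inter_rel => -[|k] //; have [] := DP k.
have fstC : fst @` C = B `&` ~` N.
  rewrite fst_inter_rel; apply/seteqP; split=> [x /(_ 0%N Logic.I)|x BNx [|k] _].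
  - by rewrite C0B.
  - by rewrite C0B.
  - by have [_ ->] := DP k.
(* Entry [0] of component [k + 1] decides [H k]; it sits at position [pickle (k.+1, 0)], so
   agreement must reach one past it. *)
have decH k p q : C p -> C q -> agree (pickle (k.+1, 0%N)).+1 p.2 q.2 ->
    H k q.1 -> H k p.1.
  move=> /(_ k.+1)/= Cp /(_ k.+1)/= Cq ag; have [_ _ DH] := DP k.
  by rewrite (DH _ _ Cp) (DH _ _ Cq) ag.
have memH k x : ~ N x -> H k x <-> ~ xsection F x `<=` G k.
  move=> Nx; have [_ MH _] := HP k; split=> [Hx FG|].
    apply: Nx; apply: NP; right; exists k => //; split=> // -[y [Fy]]; apply.
    exact: FG.
  move=> /existsNP[y /not_implyP[Fy Gy]]; apply: MH; by exists y.
have [||x [xC xdis]] := @cantor_scheme R X d md td sX I sI Y F complete IF finF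
    C G (fun k => (pickle (k.+1, 0%N)).+1) cC _ sepG _.
- rewrite fstC => IBN; apply: IB.
  apply: (ideal_sub sI) (idealU sI IBN IN) => x Bx.
  by have [Nx|Nx] := pselect (N x); [right|left].
- move=> k p q Cp Cq ag FG; apply: contrapT.
  have NC r : C r -> ~ N r.1.
    by move=> Cr; have [] : (B `&` ~` N) r.1 by rewrite -fstC; exists r.
  by move=> /(memH k _ (NC _ Cq))/(decH _ _ _ Cp Cq ag)/(memH k _ (NC _ Cp)); exact.
exists x; split=> // b; have := xC b; rewrite fstC => -[Bx Nx]; split=> //.
apply: contrapT => no; apply: Nx; apply: NP; left => -[[z y] Fzy /= zx].
by apply: no; exists y; apply/xsectionP; rewrite -zx.
Qed.

End DisjointSections.

(** * The Bernstein-style choice of points *)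

Theorem theorem2p4 (R : realType) (X Y : topologicalType) (I : set (set X))
    (F : set (X * Y)) :
  polish_ideal_space R I -> ccc I ->
  polish R Y -> uncountable Y ->
  analytic R F ->
  (forall y : Y, I (ysection F y)) ->
  I (~` (fst @` F)) ->
  (forall x : X, finite_set (xsection F x)) ->
  exists T : set Y, completely_nonmeasurable I (rel_preimage F T).
Proof.
move=> pI cI pY _ aF IF fullF finF.
have [sX [d [md td _]]] := pis_polish pI.
have sI := pis_sigma_ideal pI.
have [code codeP] := souslin_code md td sX.
have posT : borel_plus I [set: X] by split; [exact: borel_setT|exact: pis_proper pI].
(* Stage [j] treats the positive Borel set coded by the tail of [j], on the side given by [j 0]. *)
pose tail (j : nat -> bool) n := j n.+1.
(* A tail coding no positive Borel set gets the whole space, which is positive as [I] is proper, so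
   every stage has points to choose from. *)
pose B j := if pselect (borel_plus I (code (tail j))) then code (tail j) else setT.
have /choice[x xP] j : exists x : (nat -> bool) -> X,
    (forall b, B j (x b) /\ xsection F (x b) !=set0) /\
    forall b c y, F (x b, y) -> F (x c, y) -> b = c.
  by apply: (disjoint_sections_in pI cI pY aF IF fullF finF); rewrite /B; case: pselect.
(* The candidates in [disjoint_selection] are indexed by sequences in [K]; such a sequence is packed
   injectively into one branch. *)
pose diag (b : nat -> nat -> bool) n :=
  if unpickle n is Some (i, k) then b i k else false.
have diag_inj : injective diag.
  move=> b c bc; apply: funext => i; apply: funext => k.
  by have := congr1 (fun f => f (pickle (i, k))) bc; rewrite /diag pickleK.
have [|j b c y Fb Fc|c cP] :=
    @disjoint_selection (nat -> bool) Y (fun j b => xsection F (x j (diag b))).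
- by move=> j b; exact: finite_set_countable.
- by apply: diag_inj; have [_ dis] := xP j; apply: dis; apply/xsectionP; [exact: Fb|exact: Fc].
pose z j := x j (diag (c j)).
exists (\bigcup_(j in [set j : nat -> bool | j 0%N]) xsection F (z j)) => A posA.
have [a aA] : exists a, code a = A.
  by apply: codeP; apply: (souslin_borel md td); have [] := posA.
(* The two stages that treat [A]: the section chosen at [true] is part of [T], and by [cP] the one
   chosen at [false] misses [T]. *)
pose jj (i : bool) n := if n is m.+1 then a m else i.
have BA i : B (jj i) = A.
  by rewrite /B (_ : tail (jj i) = a) // aA; case: pselect.
have zA i : A (z (jj i)) /\ xsection F (z (jj i)) !=set0.
  by have [+ _] := xP (jj i); rewrite BA; exact.
split.
  have [Az [y Fy]] := zA true; exists (z (jj true)); split=> //.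
  by exists y; split=> //; exists (jj true).
have [Az _] := zA false; exists (z (jj false)); split=> // -[y [Fy [j /= j0 Fj]]].
by have jE := cP _ _ _ Fy Fj; rewrite -jE in j0.
Qed.
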